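(* Let $Ath:=\Diamond\Diamond p\to\square\Diamond p$, and let $\Lambda$ be either $\mathbf{K}+Ath$ or $\mathbf{K}+\square^n\bot+Ath$ for some $n\geq 1$. Then $\mathbf{Q}\Lambda\!-\!1$ has the finite model property, i.e., it is complete with respect to finite Kripke frames with finite domains: for every 1-variable formula $A$, $A_*\in\mathbf{Q}\Lambda\!-\!1$ if and only if $A$ is valid in every predicate Kripke frame $(W,R,D)$ such that $(W,R,D)$ validates $\mathbf{Q}\Lambda$, $W$ is finite, and $D_u$ is finite for every $u\in W$.
   Context: All propositional modal logics are normal; $\Lambda$ is in the language with the modality $\square$ (dual $\Diamond$). $L+A$ denotes the smallest normal modal logic containing $L$ and the formula $A$; $\mathbf{K}$ is the minimal normal modal logic; $\square^n$ is $\square$ iterated $n$ times. Modal predicate formulas are built from predicate letters (no function symbols, constants or equality; 0-ary letters serve as proposition letters) with Boolean connectives, quantifiers and $\square$. A modal predicate logic is a set of such formulas containing the standard classical first-order axioms and the axiom $\square(p\to q)\to(\square p\to\square q)$, and closed under modus ponens, generalization, necessitation and predicate substitution. $\mathbf{Q}\Lambda$ is the smallest modal predicate logic containing $\Lambda$. A 1-variable formula is one constructed from a single individual variable $x$ and monadic predicate letters. For a 1-variable formula $A$, $A_*$ is the bimodal propositional formula (with modalities $\square$, $\blacksquare$) obtained by replacing every atom $P_i(x)$ with a proposition letter $p_i$ and every quantifier $\forall x$ with $\blacksquare$. For a modal predicate logic $L$, its 1-variable fragment is $L\!-\!1:=\{A_*\mid A\in L,\ A\text{ is 1-variable}\}$.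 A predicate Kripke frame is a triple $(W,R,D)$ where $(W,R)$ is a Kripke frame and $D=(D_u)_{u\in W}$ is a family of nonempty sets with $D_u\subseteq D_v$ whenever $uRv$. A valuation interprets each $k$-ary predicate letter at each $u\in W$ as a $k$-ary relation on $D_u$; truth at $u$ of formulas with parameters from $D_u$ is defined as usual, with quantifiers at $u$ ranging over $D_u$ and $\square$ over $R$-successors of $u$. A formula is valid in $(W,R,D)$ if under every valuation its universal closure is true at every $u\in W$; a frame validates a logic if all formulas of the logic are valid in it. *)

(* Defs.v *)
From mathcomp Require Import all_boot.
From mathcomp Require Import boolp classical_sets functions cardinality.

Set Implicit Arguments.
Unset Strict Implicit.
Unset Printing Implicit Defensive.

Local Open Scope classical_set_scope.

(* ** Propositional modal logics *)

Inductive mform : Type :=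
| MVar of nat
| MBot
| MImp of mform & mform
| MBox of mform.

Definition MNot (A : mform) : mform := MImp A MBot.
Definition MDia (A : mform) : mform := MNot (MBox (MNot A)).

Fixpoint msubst (s : nat -> mform) (A : mform) : mform :=
  match A with
  | MVar i => s i
  | MBot => MBot
  | MImp A B => MImp (msubst s A) (msubst s B)
  | MBox A => MBox (msubst s A)
  end.

Record normal_logic (L : set mform) : Prop := NormalLogic {
  nl_k : forall A B, L (MImp A (MImp B A));
  nl_s : forall A B C,
    L (MImp (MImp A (MImp B C)) (MImp (MImp A B) (MImp A C)));
  nl_dn : forall A, L (MImp (MNot (MNot A)) A);
  nl_box : L (MImp (MBox (MImp (MVar 0) (MVar 1)))
                   (MImp (MBox (MVar 0)) (MBox (MVar 1))));
  nl_mp : forall A B, L (MImp A B) -> L A -> L B;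
  nl_nec : forall A, L A -> L (MBox A);
  nl_subst : forall (s : nat -> mform) A, L A -> L (msubst s A)
}.

Definition logicK : set mform :=
  [set A | forall L : set mform, normal_logic L -> L A].

Definition logic_add (L : set mform) (A : mform) : set mform :=
  [set B | forall L' : set mform,
             normal_logic L' -> L `<=` L' -> L' A -> L' B].

Definition Ath : mform :=
  MImp (MDia (MDia (MVar 0))) (MBox (MDia (MVar 0))).

(* ** Modal predicate formulas *)

(* Formulas are represented up to renaming of bound variables, by de Bruijn
   indices.  [PAtom k i xs] is the [i]-th [k]-ary predicate letter applied to
   the variables [xs]; at the top level the index [j] stands for the [j]-th
   individual variable, and [PAll] binds index 0 of its body. *)
Inductive pform : Type :=
| PAtom (k i : nat) (xs : k.-tuple nat)
| PBot
| PImp of pform & pform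
| PBox of pform
| PAll of pform.

Definition PNot (A : pform) : pform := PImp A PBot.

Definition PLetter (i : nat) : pform := @PAtom 0 i [tuple].

Definition up (f : nat -> nat) (j : nat) : nat :=
  if j is j'.+1 then (f j').+1 else 0.

(* Capture-avoiding replacement of every free variable [j] by [f j]. *)
Fixpoint prename (f : nat -> nat) (A : pform) : pform :=
  match A with
  | PAtom k i xs => PAtom i [tuple of map f xs]
  | PBot => PBot
  | PImp A B => PImp (prename f A) (prename f B)
  | PBox A => PBox (prename f A)
  | PAll A => PAll (prename (up f) A)
  end.

(* [pinst y A] is A(y), for [PAll A] read as "for all x, A(x)". *)
Definition pinst (y : nat) (A : pform) : pform :=
  prename (fun j => if j is j'.+1 then j' else y) A.

(* Predicate substitution.  In [s k i], the formula put for the [i]-th [k]-ary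
   letter, the variables 0, .., k-1 stand for the arguments of the letter and
   the variable k+j for the parameter x_j.  The number [d] counts the
   quantifiers passed so far, by which parameters are shifted so that they are
   not captured; beyond the length of [xs], [nth] returns its default value. *)
Fixpoint psubst_rec (d : nat) (s : nat -> nat -> pform) (A : pform) : pform :=
  match A with
  | PAtom k i xs => prename (fun j => nth (d + (j - k)) xs j) (s k i)
  | PBot => PBot
  | PImp A B => PImp (psubst_rec d s A) (psubst_rec d s B)
  | PBox A => PBox (psubst_rec d s A)
  | PAll A => PAll (psubst_rec d.+1 s A)
  end.

Definition psubst : (nat -> nat -> pform) -> pform -> pform := psubst_rec 0.

(* In [mpl_all], [prename succn A] is [A] seen in the scope of one more
   quantifier, whose variable therefore is not free in it. *)
Record modal_pred_logic (L : set pform) : Prop := ModalPredLogic {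
  mpl_k : forall A B, L (PImp A (PImp B A));
  mpl_s : forall A B C,
    L (PImp (PImp A (PImp B C)) (PImp (PImp A B) (PImp A C)));
  mpl_dn : forall A, L (PImp (PNot (PNot A)) A);
  mpl_inst : forall A y, L (PImp (PAll A) (pinst y A));
  mpl_all : forall A B,
    L (PImp (PAll (PImp (prename succn A) B)) (PImp A (PAll B)));
  mpl_box : L (PImp (PBox (PImp (PLetter 0) (PLetter 1)))
                    (PImp (PBox (PLetter 0)) (PBox (PLetter 1))));
  mpl_mp : forall A B, L (PImp A B) -> L A -> L B;
  mpl_gen : forall A, L A -> L (PAll A);
  mpl_nec : forall A, L A -> L (PBox A);
  mpl_subst : forall (s : nat -> nat -> pform) A, L A -> L (psubst s A)
}.

Fixpoint pform_of (A : mform) : pform :=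
  match A with
  | MVar i => PLetter i
  | MBot => PBot
  | MImp A B => PImp (pform_of A) (pform_of B)
  | MBox A => PBox (pform_of A)
  end.

Definition logicQ (Lam : set mform) : set pform :=
  [set A | forall L : set pform,
             modal_pred_logic L -> pform_of @` Lam `<=` L -> L A].

(* ** One-variable fragments *)

(* When only one individual variable x is used, every occurrence of x is bound
   by the innermost quantifier around it (or is free if there is none), so its
   de Bruijn index is 0; conversely, a formula whose only index is 0 can be
   written with a single variable. *)
Fixpoint onevar (A : pform) : bool :=
  match A with
  | PAtom k i xs => val xs == [:: 0]
  | PBot => true
  | PImp A B => onevar A && onevar B
  | PBox A => onevar A
  | PAll A => onevar A
  end.

Inductive bform : Type :=
| BVar of nat
| BBot
| BImp of bform & bform
| BBox of bform
| BBlack of bform.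

(* The translation A_*, meaningful only for one-variable formulas. *)
Fixpoint star (A : pform) : bform :=
  match A with
  | PAtom k i xs => BVar i
  | PBot => BBot
  | PImp A B => BImp (star A) (star B)
  | PBox A => BBox (star A)
  | PAll A => BBlack (star A)
  end.

Definition fragment1 (L : set pform) : set bform :=
  star @` [set A | L A /\ onevar A].

(* ** Predicate Kripke frames *)

Record pframe : Type := PFrame {
  world : Type;
  acc : world -> world -> Prop;
  indiv : Type;
  dom : world -> set indiv;
  world_ne : inhabited world;
  dom_ne : forall u, dom u !=set0;
  dom_mono : forall u v, acc u v -> dom u `<=` dom v
}.

(* [V u k i] is a relation on the ambient type of individuals; since truth at
   [u] is only considered under assignments with values in [dom u], only its
   restriction to [dom u] matters. *)
Definition valuation (F : pframe) : Type :=
  world F -> forall k : nat, nat -> set (k.-tuple (indiv F)).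

Definition scons (T : Type) (a : T) (e : nat -> T) (j : nat) : T :=
  if j is j'.+1 then e j' else a.

Fixpoint truth (F : pframe) (V : valuation F) (u : world F)
    (e : nat -> indiv F) (A : pform) : Prop :=
  match A with
  | PAtom k i xs => V u k i [tuple of map e xs]
  | PBot => False
  | PImp A B => truth V u e A -> truth V u e B
  | PBox A => forall v, acc u v -> truth V v e A
  | PAll A => forall a, dom u a -> truth V u (scons a e) A
  end.

(* The free variables of [A] are among 0, .., pfree_bound A - 1. *)
Fixpoint pfree_bound (A : pform) : nat :=
  match A with
  | PAtom k i xs => \max_(x <- xs) x.+1
  | PBot => 0
  | PImp A B => maxn (pfree_bound A) (pfree_bound B)
  | PBox A => pfree_bound A
  | PAll A => (pfree_bound A).-1
  end.

Definition univ_closure (A : pform) : pform := iter (pfree_bound A) PAll A.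

(* As [univ_closure A] has no free variables, the choice of [e] is
   immaterial. *)
Definition valid (F : pframe) (A : pform) : Prop :=
  forall (V : valuation F) (u : world F) (e : nat -> indiv F),
    (forall j, dom u (e j)) -> truth V u e (univ_closure A).

Definition validates (F : pframe) (L : set pform) : Prop :=
  forall A, L A -> valid F A.

Definition finite_pframe (F : pframe) : Prop :=
  finite_set [set: world F] /\ forall u : world F, finite_set (dom u).

(* Main.v *)
(* Individuals of a Kripke model become maximal consistent sets of bimodal
   formulas, a world being a set of such individuals that agree on all
   formulas of the form [BBlack A]. Starting from a point refuting the
   formula, one builds finite layers of worlds, every world of a layer
   seeing exactly the worlds of the next one, which makes [Ath] valid. For
   each unwitnessed box at an individual [a] of the current layer, the
   next layer gets a world containing a canonical successor of [a] that
   refutes the boxed formula. All the other individuals of the current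
   layer must also have successors in that world: within a world this is
   the commutation [BBox (BBlack A) -> BBlack (BBox A)], which expresses
   expanding domains; across worlds it follows because all of them share
   an individual and, by [Ath], all successors of a point have the same
   successors. Only finitely many boxes and quantifiers need a witness,
   and layers beyond the box depth of the formula are irrelevant. *)

Require Import Defs.
From HB Require Import structures.
From mathcomp Require Import all_boot.
From mathcomp Require Import boolp classical_sets functions cardinality.

Set Implicit Arguments.
Unset Strict Implicit.
Unset Printing Implicit Defensive.

Local Open Scope classical_set_scope.

(** * Soundness of predicate Kripke frames *)

Lemma truth_prename (F : pframe) (V : valuation F) A u (e : nat -> indiv F) f :
  truth V u e (prename f A) <-> truth V u (e \o f) A.
Proof.
elim: A u e f => [k i xs|//|A IHA B IHB|A IHA|A IHA] u e f /=.
- by split; congr (V u k i _); apply: val_inj; rewrite /= -map_comp.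
- by split=> h /IHA hA; apply/IHB/h.
- by split=> h v uv; apply/IHA/h.
- by split=> h a ua; move: (h a ua); rewrite IHA; congr truth; apply/funext;
    case.
Qed.

(** Substitution is absorbed into the valuation. [e0] is the assignment outside the [d] quantifiers
    passed, hence the one that interprets parameters. *)
Lemma truth_psubst (F : pframe) (V : valuation F) s (e0 : nat ->
  indiv F) A d u e :
  (forall j, e (d + j) = e0 j) ->
  truth V u e (psubst_rec d s A) <->
  truth (fun v k i xs => truth V v (fun j => nth (e0 (j - k)) xs j) (s k i)) u e A.
Proof.
elim: A d u e => [k i xs|//|A IHA B IHB|A IHA|A IHA] d u e he /=.
- rewrite truth_prename.
  suff -> : e \o (fun j => nth (d + (j - k)) xs j) =
            (fun j => nth (e0 (j - k)) [tuple of map e xs] j) by [].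
  apply/funext => j /=; have [jk|kj] := ltnP j k;
    last by rewrite !nth_default ?size_tuple.
  by rewrite (nth_map 0) ?size_tuple //; congr (e _); apply: set_nth_default;
    rewrite size_tuple.
- by split=> h /(IHA _ _ _ he) hA; apply/(IHB _ _ _ he)/h.
- by split=> h v uv; apply/(IHA _ _ _ he)/h.
- by split=> h a ua; apply/(IHA d.+1)/h.
Qed.

(** Free variables are read under all assignments rather than closed off, which makes closure under
    the rules direct. *)
Definition frame_logic (F : pframe) : set pform := fun A =>
  forall (V : valuation F) u e, (forall j, dom u (e j)) -> truth V u e A.

Lemma frame_logic_valid F A : frame_logic F A -> valid F A.
Proof.
move=> hA V u; rewrite /univ_closure; elim: (pfree_bound A) => [|n IHn] e he.
  exact: hA.
by move=> a ua; apply: IHn; case.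
Qed.

Lemma valid_const F A (V : valuation F) u a :
  valid F A -> dom u a -> truth V u (fun=> a) A.
Proof.
move=> hA ua; have {hA} := hA V u (fun=> a) (fun=> ua); rewrite /univ_closure.
elim: (pfree_bound A) => [//|n IHn] /= /(_ a ua) h; apply: IHn.
by move: h; congr truth; apply/funext; case.
Qed.

Lemma frame_logicP F : modal_pred_logic (frame_logic F).
Proof.
split=> [A B|A B C|A|A y|A B||A B hAB hA|A hA|A hA|s A hA] V u e he /=;
  first by [].
- by move=> hABC hAB hA; apply: hABC => //; apply: hAB.
- exact: contrapT.
- move=> /(_ _ (he y)) h; rewrite truth_prename; move: h; congr truth.
  by apply/funext; case.
- move=> h hA a ua; apply: h => //; rewrite truth_prename.
  by move: hA; congr truth; apply/funext.
- by move=> h0 h1 v uv; apply: (h0 v uv); apply: h1.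
- exact: hAB (hA _ _ _ he).
- by move=> a ua; apply: hA; case.
(* Expanding domains keep the assignment inside the domain of the successor. *)
- by move=> v uv; apply: hA => j; apply: dom_mono uv _ (he j).
- by rewrite (@truth_psubst F V s e A 0) //; apply: hA.
Qed.

(** * Propositional formulas inside predicate logics *)

Lemma prename_pform_of f A : prename f (pform_of A) = pform_of A.
Proof.
elim: A => //= [i|A -> B ->|A ->] //.
by rewrite /PLetter; congr PAtom; apply: val_inj.
Qed.

Lemma prename_id A : prename id A = A.
Proof.
elim: A => //= [k i xs|A -> B ->|A ->|A IHA] //.
  by congr PAtom; apply: val_inj; rewrite /= map_id.
by congr PAll; rewrite -[RHS]IHA; congr prename; apply/funext; case.
Qed.

(* The renaming by which [psubst] handles a 0-ary letter outside quantifiers. *)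
Lemma psubst0_rename : (fun j : nat => nth (0 + (j - 0)) [::] j) = id.
Proof. by apply/funext => j; rewrite nth_nil subn0. Qed.

Lemma psubst_pform_of s A :
  psubst (fun _ i => pform_of (s i)) (pform_of A) = pform_of (msubst s A).
Proof.
by rewrite /psubst; elim: A => //= [i|A -> B ->|A ->] //;
  apply: prename_pform_of.
Qed.

(** Membership in [Lam] quantifies over normal logics; this instantiates it with the propositional
    part of a predicate logic, such as that of a frame. *)
Lemma normal_logic_pform_of L :
  modal_pred_logic L -> normal_logic (fun A => L (pform_of A)).
Proof.
case=> k s dn _ _ bx mp _ nec sb; split=> //=.
- by move=> A; apply: dn.
- by move=> A B; apply: mp.
- by move=> A; apply: nec.
- by move=> f A /(sb (fun _ i => pform_of (f i))); rewrite psubst_pform_of.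
Qed.

Lemma logicQP Lam : modal_pred_logic (logicQ Lam).
Proof.
split=> /=.
- by move=> A B L hL _; apply: mpl_k.
- by move=> A B C L hL _; apply: mpl_s.
- by move=> A L hL _; apply: mpl_dn.
- by move=> A y L hL _; apply: mpl_inst.
- by move=> A B L hL _; apply: mpl_all.
- by move=> L hL _; apply: mpl_box.
- by move=> A B hAB hA L hL LamL;
    exact: (mpl_mp hL (hAB L hL LamL) (hA L hL LamL)).
- by move=> A hA L hL LamL; apply: mpl_gen => //; exact: hA.
- by move=> A hA L hL LamL; apply: mpl_nec => //; exact: hA.
- by move=> s A hA L hL LamL; apply: mpl_subst => //; exact: hA.
Qed.

(** * Theories and maximal consistent sets of bimodal formulas *)

Definition BNot (A : bform) : bform := BImp A BBot.

(** [BBlack] is an S5 modality, standing for the quantifier; [bl_com] expresses expanding domains,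
    and [bl_ath] is [Ath] as a schema with its diamonds unfolded. *)
Record bimodal_logic (L : set bform) : Prop := BimodalLogic {
  bl_k : forall A B, L (BImp A (BImp B A));
  bl_s : forall A B C,
    L (BImp (BImp A (BImp B C)) (BImp (BImp A B) (BImp A C)));
  bl_dn : forall A, L (BImp (BNot (BNot A)) A);
  bl_mp : forall A B, L (BImp A B) -> L A -> L B;
  bl_box : forall A B, L (BImp (BBox (BImp A B)) (BImp (BBox A) (BBox B)));
  bl_nec : forall A, L A -> L (BBox A);
  bl_black : forall A B,
    L (BImp (BBlack (BImp A B)) (BImp (BBlack A) (BBlack B)));
  bl_gen : forall A, L A -> L (BBlack A);
  bl_inst : forall A, L (BImp (BBlack A) A);
  bl_4 : forall A, L (BImp (BBlack A) (BBlack (BBlack A)));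
  bl_5 : forall A, L (BImp (BNot (BBlack A)) (BBlack (BNot (BBlack A))));
  bl_com : forall A, L (BImp (BBox (BBlack A)) (BBlack (BBox A)));
  bl_ath : forall A,
    L (BImp (BNot (BBox (BNot (BNot (BBox (BNot A))))))
            (BBox (BNot (BBox (BNot A)))))
}.

Record theory (L T : set bform) : Prop := Theory {
  th_logic : forall A, L A -> T A;
  th_mp : forall A B, T (BImp A B) -> T A -> T B
}.

Record mcs (L T : set bform) : Prop := Mcs {
  mcs_th : theory L T;
  mcs_bot : ~ T BBot;
  mcs_em : forall A, T A \/ T (BNot A)
}.

Section Bimodal.
Variables (L : set bform) (bl : bimodal_logic L).

Definition deduce (T : set bform) (A : bform) : set bform :=
  fun B => T (BImp A B).

Lemma deduce_sub T A B : theory L T -> T B -> deduce T A B.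
Proof. by case=> l mp; apply: mp; apply: l; apply: bl_k. Qed.

Lemma deduce_self T A : theory L T -> deduce T A A.
Proof.
case=> l mp; apply: l.
exact: (bl_mp bl (bl_mp bl (bl_s bl A (BImp A A) A) (bl_k bl A (BImp A A)))
  (bl_k bl A A)).
Qed.

Lemma deduce_theory T A : theory L T -> theory L (deduce T A).
Proof.
move=> th; have [l mp] := th; split=> [B LB|B C TBC TB].
  by apply: deduce_sub => //; apply: l.
exact: (mp _ _ (mp _ _ (l _ (bl_s bl A B C)) TBC) TB).
Qed.

Lemma exfalso T A : theory L T -> T BBot -> T A.
Proof.
move=> th Tb; have [l mp] := th; apply: (mp _ _ (l _ (bl_dn bl A))).
exact: deduce_sub.
Qed.

(* The union with [T] in the poset given to Zorn's lemma makes the empty chain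
   harmless. *)
Lemma lindenbaum T C : theory L T -> ~ T C ->
  exists D, [/\ mcs L D, T `<=` D & ~ D C].
Proof.
move=> th nTC.
pose P (X : set bform) := theory L (X `|` T) /\ ~ (X `|` T) C.
have [F FP Ft|M [[thM nMC] Mmax]] := @Zorn_bigcup _ P.
  split; last by case=> [[X FX XC]|//]; case: (FP X FX) => _; apply; left.
  split=> [A LA|A B]; first by right; apply: th_logic LA.
  have sub X : F X -> X `|` T `<=` (\bigcup_(Y in F) Y) `|` T.
    by move=> FX D [XD|]; [left; exists X|right].
  have mpF X D E : F X -> (X `|` T) (BImp D E) -> (X `|` T) D ->
      ((\bigcup_(Y in F) Y) `|` T) E.
    by move=> FX h1 h2; apply: (sub X FX); case: (FP X FX) => tX _;
      exact: (th_mp tX h1 h2).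
  case=> [[X FX XAB]|TAB] [[Y FY YA]|TA].
  - have [XY|YX] := Ft X Y FX FY.
      by apply: (mpF Y A) => //; left => //; apply: XY.
    by apply: (mpF X A) => //; left => //; apply: YX.
  - by apply: (mpF X A) => //; [left|right].
  - by apply: (mpF Y A) => //; [right|left].
  - by right; exact: (th_mp th TAB TA).
set D := M `|` T in thM nMC.
(* By maximality, adding a formula outside [D] must make [C] derivable. *)
have maxD B : D B \/ D (BImp B C).
  have [DB|nDB] := pselect (D B); [by left|right].
  apply: contrapT => nDBC.
  have sub : M `<=` deduce D B by move=> A MA; apply: deduce_sub => //; left.
  have eD : deduce D B `|` T = deduce D B.
    apply/seteqP; split=> A; last by left.
    by case=> // TA; apply: deduce_sub => //; right.
  apply: (Mmax (deduce D B)); last by split; rewrite eD //;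
    exact: deduce_theory.
  by split=> // /(_ B (deduce_self B thM)) MB; apply: nDB; left.
exists D; split=> //; last by move=> A TA; right.
split=> // [Db|B]; first by apply: nMC; apply: exfalso.
have [DB|nDB] := pselect (D B); [by left|right].
(* If [D] lacked both [B] and its negation, each would imply [C], and [C] would follow by cases. *)
have [//|nBC] := maxD (BNot B).
have [//|BC] := maxD B; case: nMC.
apply: (th_mp thM (th_logic thM (bl_dn bl C))).
have th1 := deduce_theory (BNot C) thM.
have d1 A : D A -> deduce D (BNot C) A by exact: deduce_sub.
have nC : deduce D (BNot C) (BNot C) by exact: deduce_self.
apply: (th_mp th1 nC); apply: (th_mp th1 (d1 _ nBC)).
have th2 := deduce_theory B th1.
apply: (th_mp th2 (deduce_sub _ th1 nC)).
by apply: (th_mp th2 (deduce_sub _ th1 (d1 _ BC))); apply: deduce_self.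
Qed.

Lemma mcs_imp T A B : mcs L T -> T (BImp A B) <-> (T A -> T B).
Proof.
case=> th nb em; split=> [TAB TA|h]; first exact: (th_mp th TAB TA).
have [/h TB|nA] := em A; first exact: deduce_sub.
have th1 := deduce_theory A th; apply: (exfalso B th1).
exact: (th_mp th1 (deduce_sub _ th nA) (deduce_self _ th)).
Qed.

Lemma mcs_not T A : mcs L T -> T (BNot A) <-> ~ T A.
Proof.
move=> mT; rewrite mcs_imp //; split=> h TA; first exact: mcs_bot mT (h TA).
by have := h TA.
Qed.

Lemma mcs_ax T A B : mcs L T -> L (BImp A B) -> T A -> T B.
Proof. by move=> mT LAB; apply/(mcs_imp _ _ mT)/(th_logic (mcs_th mT)). Qed.

Lemma complete A : (forall T, mcs L T -> T A) -> L A.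
Proof.
move=> h; apply: contrapT => nA.
have thL : theory L L by split=> //; apply: bl_mp.
by have [T [mT _]] := lindenbaum thL nA; apply; apply: h.
Qed.

Lemma mcs_box_mono T A B : mcs L T -> L (BImp A B) -> T (BBox A) -> T (BBox B).
Proof.
by move=> mT LAB; apply: mcs_ax => //;
  apply: (bl_mp bl (bl_box bl _ _) (bl_nec bl LAB)).
Qed.

Lemma mcs_box_mp T A B : mcs L T -> T (BBox (BImp A B)) -> T (BBox A) ->
  T (BBox B).
Proof. by move=> mT h;
  apply/(mcs_imp _ _ mT)/(mcs_ax mT (bl_box bl _ _) h). Qed.

(** * Canonical relations between maximal consistent sets *)

Definition canR (S T : set bform) := forall A, S (BBox A) -> T A.
Definition canE (S T : set bform) := forall A, S (BBlack A) <-> T (BBlack A).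

Lemma canE_sym S T : canE S T -> canE T S.
Proof. by move=> h A; rewrite h. Qed.
Lemma canE_trans S T U : canE S T -> canE T U -> canE S U.
Proof. by move=> h h' A; rewrite h h'. Qed.

Lemma canE_sub S T : mcs L S -> mcs L T ->
  (forall A, S (BBlack A) -> T (BBlack A)) -> canE S T.
Proof.
move=> mS mT h A; split; first exact: h.
apply: contraPP => /(mcs_not _ mS) /(mcs_ax mS (bl_5 bl _)) /h.
by move=> /(mcs_ax mT (bl_inst bl _)) /(mcs_not _ mT).
Qed.

Lemma box_witness S C : mcs L S -> ~ S (BBox C) ->
  exists T, [/\ mcs L T, canR S T & ~ T C].
Proof.
move=> mS; apply: (@lindenbaum (fun A => S (BBox A))).
split=> [A LA|A B]; last exact: mcs_box_mp.
exact: (th_logic (mcs_th mS) (bl_nec bl LA)).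
Qed.

(** The conclusion is conditional so that witnesses can be chosen for all [C] at once. *)
Lemma black_witness S C : mcs L S ->
  exists T, [/\ mcs L T, canE T S & (~ S (BBlack C) -> ~ T C)].
Proof.
move=> mS; have [SC|nSC] := pselect (S (BBlack C)); first by exists S.
have [|T [mT ST nTC]] := @lindenbaum (fun A => S (BBlack A)) C _ nSC.
  split=> [A LA|A B h]; first exact: (th_logic (mcs_th mS) (bl_gen bl LA)).
  exact/(mcs_imp _ _ mS)/(mcs_ax mS (bl_black bl _ _) h).
exists T; split=> //; apply/canE_sym/canE_sub => // A SA.
exact: (ST _ (mcs_ax mS (bl_4 bl _) SA)).
Qed.

(** Commutation completes the square: the boxed part of [S'] is consistent with the [BBlack]
    formulas of [T]. *)
Lemma canR_canE S S' T : mcs L S -> mcs L S' -> mcs L T ->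
  canE S' S -> canR S T -> exists T', [/\ mcs L T', canR S' T' & canE T' T].
Proof.
move=> mS mS' mT eS RST.
(* [U] is what these two sets jointly imply; a single [E] suffices because [BBlack] formulas are
   closed under conjunction, which is [G] below. *)
pose U D := exists2 E, T (BBlack E) & S' (BBox (BImp (BBlack E) D)).
have thU : theory L U.
  split=> [A LA|A B [E TE SE] [F TF SF]].
    exists (BImp A A).
      by apply: (th_logic (mcs_th mT)); apply/(bl_gen bl)/complete => X mX;
        apply/(mcs_imp _ _ mX).
    apply: (th_logic (mcs_th mS')); apply/(bl_nec bl)/complete => X mX.
    by apply/(mcs_imp _ _ mX) => _; apply: th_logic LA; case: mX.
  pose G := BNot (BImp E (BNot F)).
  have GE X : mcs L X -> X G <-> X E /\ X F.
    move=> mX; rewrite !(mcs_not _ mX) (mcs_imp _ _ mX) (mcs_not _ mX).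
    by split=> [h|[hE hF] /(_ hE)//]; split; apply: contrapT => nh; apply: h.
  have LG H : L (BImp G H) -> L (BImp (BBlack G) (BBlack H)).
    by move=> /(bl_gen bl); apply: (bl_mp bl); exact: bl_black.
  have LGE : L (BImp (BBlack G) (BBlack E)).
    by apply/LG/complete => X mX; apply/(mcs_imp _ _ mX) => /(GE _ mX) [].
  have LGF : L (BImp (BBlack G) (BBlack F)).
    by apply/LG/complete => X mX; apply/(mcs_imp _ _ mX) => /(GE _ mX) [].
  exists G.
    have LEFG : L (BImp E (BImp F G)).
      apply: complete => X mX; apply/(mcs_imp _ _ mX) => XE.
      by apply/(mcs_imp _ _ mX) => XF; apply/(GE _ mX).
    have := bl_mp bl (bl_black bl _ _) (bl_gen bl LEFG) => /(mcs_ax mT) /(_ TE).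
    by move=> /(mcs_ax mT (bl_black bl _ _)) /(mcs_imp _ _ mT); apply.
  apply: (mcs_box_mp mS') SF; apply: mcs_box_mono (mS') _ SE.
  apply: complete => X mX; apply/(mcs_imp _ _ mX) => hE.
  apply/(mcs_imp _ _ mX) => hF; apply/(mcs_imp _ _ mX) => hG.
  move/(mcs_imp _ _ mX): hE => /(_ (mcs_ax mX LGE hG)) /(mcs_imp _ _ mX); apply.
  by move/(mcs_imp _ _ mX): hF; apply; apply: mcs_ax hG.
have nU : ~ U BBot.
  (* Axiom 5 puts [BBlack] under the box, [bl_com] moves it in front, and [eS] then carries the
     formula from [S'] to [S]. *)
  move=> [E TE SE]; suff : T (BNot (BBlack E)) by move/(mcs_not _ mT).
  apply: RST; apply: (mcs_ax mS (bl_inst bl _)); apply/eS.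
  apply: (mcs_ax mS' (bl_com bl _)); apply: mcs_box_mono SE => //.
  exact: bl_5.
have [T' [mT' UT' _]] := lindenbaum thU nU.
exists T'; split=> //.
  move=> A SA; apply: UT'; exists (BImp BBot BBot).
    by apply: (th_logic (mcs_th mT)); apply/(bl_gen bl)/complete => X mX;
      apply/(mcs_imp _ _ mX).
  by apply: mcs_box_mono SA => //; apply: bl_k.
apply/canE_sym/canE_sub => // A TA; apply: UT'; exists A => //.
apply: (th_logic (mcs_th mS')); apply/(bl_nec bl)/complete => X mX.
by apply/(mcs_imp _ _ mX).
Qed.

(** If [U] lacked [A], then [S] would have a double diamond of its negation, so [Ath] would give
    [T'] a diamond of it, against [BBox A]. *)
Lemma canR_ath S T T' U : mcs L S -> mcs L T -> mcs L T' -> mcs L U ->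
  canR S T -> canR S T' -> canR T U -> canR T' U.
Proof.
move=> mS mT mT' mU ST ST' TU A TA; apply: contrapT => nUA.
pose B := BNot A.
have dB X : mcs L X -> X A -> X (BNot B).
  by move=> mX XA; apply/(mcs_not _ mX) => /(mcs_not _ mX).
have : S (BBox (BNot (BBox (BNot B)))).
  apply: (mcs_ax mS (bl_ath bl B)); apply/(mcs_not _ mS) => /ST /(mcs_not _ mT).
  by apply; apply/(mcs_not _ mT) => /TU /(mcs_not _ mU); apply;
    apply/(mcs_not _ mU).
move=> /ST' /(mcs_not _ mT'); apply; apply: mcs_box_mono TA => //.
by apply: complete => X mX; apply/(mcs_imp _ _ mX) => XA; apply: dB.
Qed.

End Bimodal.

(** * Layers of worlds *)

HB.instance Definition _ := gen_eqMixin bform.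

(* The individual [(i, j, C)] is born in world [j] of layer [i], as a witness
   for [C]. *)
Definition name : Type := (nat * nat * bform)%type.

(** [ltype j a] is the set of formulas meant to hold of [a] in world [j]; it is meaningful only for
    [j < lsize] and [a] in [ldom j]. *)
Record layer : Type := Layer {
  lsize : nat;
  ldom : nat -> seq name;
  ltype : nat -> name -> set bform
}.

Section Layers.
Variables (L : set bform) (bl : bimodal_logic L) (Phi : seq bform).

(** [co_level] keeps the names of later layers fresh; [co_next] is the form in which [Ath] is used;
    [co_common] links any two worlds of the layer. *)
Record coherent (i : nat) (l : layer) : Prop := Coherent {
  co_mcs : forall j a, j < lsize l -> a \in ldom l j -> mcs L (ltype l j a);
  co_level : forall j a, j < lsize l -> a \in ldom l j -> a.1.1 <= i;
  co_eq : forall j a b, j < lsize l -> a \in ldom l j -> b \in ldom l j ->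
    canE (ltype l j a) (ltype l j b);
  co_wit : forall j a C, j < lsize l -> a \in ldom l j -> C \in Phi ->
    ~ ltype l j a (BBlack C) -> exists2 b, b \in ldom l j & ~ ltype l j b C;
  co_next : forall j k a T, j < lsize l -> k < lsize l ->
    a \in ldom l j -> a \in ldom l k -> mcs L T ->
    canR (ltype l j a) T -> canR (ltype l k a) T;
  co_common : exists a, forall j, j < lsize l -> a \in ldom l j
}.

(** [st_pos] lets the height bound walk back through nonempty layers. *)
Record step (l l' : layer) : Prop := Step {
  st_acc : forall j k a, j < lsize l -> k < lsize l' -> a \in ldom l j ->
    a \in ldom l' k /\ canR (ltype l j a) (ltype l' k a);
  st_wit : forall j a C, j < lsize l -> a \in ldom l j -> C \in Phi ->
    ~ ltype l j a (BBox C) -> exists2 k, k < lsize l' & ~ ltype l' k a C;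
  st_pos : 0 < lsize l' -> 0 < lsize l
}.

(** [T] is the new world refuting [C] at [a], given as a type for every name. Its number is not
    fixed yet, so [x] is arbitrary. *)
Lemma request i l j a C : coherent i l ->
  j < lsize l -> a \in ldom l j -> ~ ltype l j a (BBox C) ->
  exists T : name -> set bform,
    [/\ forall b, mcs L (T b), forall b b', canE (T b) (T b'),
        forall k b, k < lsize l -> b \in ldom l k -> canR (ltype l k b) (T b),
        ~ T a C &
        forall x D b, ~ T b (BBlack D) -> ~ T (i.+1, x, D) D].
Proof.
move=> co jl ja nC.
have ma := co_mcs co jl ja.
have [S [mS aS nSC]] := box_witness bl ma nC.
have hE b : exists U, [/\ mcs L U, canE U S,
    forall k, k < lsize l -> b \in ldom l k -> canR (ltype l k b) U &
    b = a -> ~ U C].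
  have [->|ba] := eqVneq b a.
    by exists S; split=> // k kl kb; apply: (co_next co jl kl ja kb mS aS).
  have ba' : b <> a by apply/eqP.
  have [[k [kl kb]]|nb] := pselect (exists k, k < lsize l /\ b \in ldom l k);
    last first.
    by exists S; split=> // k kl kb; case: nb; exists k.
  (* Go from [a] to the common individual [e] inside world [j], change to world [k] along [e], then
     go from [e] to [b] inside [k]. *)
  have [e he] := co_common co.
  have [T1 [m1 eT1 T1S]] := canR_canE bl ma (co_mcs co jl (he j jl)) mS
    (co_eq co jl (he j jl) ja) aS.
  have kT1 := co_next co jl kl (he j jl) (he k kl) m1 eT1.
  have [T2 [m2 bT2 T21]] :=
    canR_canE bl (co_mcs co kl (he k kl)) (co_mcs co kl kb)
    m1 (co_eq co kl kb (he k kl)) kT1.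
  exists T2; split=> //; first exact: canE_trans T21 T1S.
  by move=> k' kl' kb'; apply: (co_next co kl kl' kb kb' m2 bT2).
have [h hP] := choice hE.
have [g gP] := choice (fun D => black_witness bl D mS).
(* Names of level at most [i] get successors of their old types; a later name gets the witness for
   the formula it carries. *)
pose T b := if b.1.1 <= i then h b else g b.2.
have TS b : canE (T b) S by rewrite /T; case: ifP => _;
  [case: (hP b)|case: (gP b.2)].
exists T; split.
- by move=> b; rewrite /T; case: ifP => _; [case: (hP b)|case: (gP b.2)].
- by move=> b b'; apply: (canE_trans (TS b)) (canE_sym (TS b')).
- by move=> k b kl kb; rewrite /T (co_level co kl kb); case: (hP b) => _ _ hR _;
    apply: hR kb.
- by rewrite /T (co_level co jl ja); case: (hP a) => _ _ _ hC; apply: hC.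
- move=> x D b nD; rewrite /T /= ltnn; case: (gP D) => _ _ hD; apply: hD => SD.
  by apply/nD/TS.
Qed.

(** One world per failing box of the layer: its number is the position in [reqs], and its domain
    adds the individuals born in it to all old ones. *)
Lemma next_layer i l : coherent i l -> exists l', coherent i.+1 l' /\ step l l'.
Proof.
move=> co.
pose pts := [seq (j, a) | j <- iota 0 (lsize l), a <- ldom l j].
pose all_reqs := [seq (p, C) | p <- pts, C <- Phi].
pose reqs := [seq r <- all_reqs | `[< ~ ltype l r.1.1 r.1.2 (BBox r.2) >]].
pose r0 : nat * name * bform := (0, (0, 0, BBot), BBot).
have reqsP j a C : reflect ([/\ j < lsize l, a \in ldom l j, C \in Phi &
    ~ ltype l j a (BBox C)]) ((j, a, C) \in reqs).
  rewrite mem_filter; apply: (iffP andP) => /= [[/asboolP nC]|[jl ja CP nC]].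
    case/allpairsP=> -[[j' a'] C'] /= [/allpairsPdep [j1 [a1 [j1l a1l ->]]] CP E].
    by case: E nC => -> -> -> nC; rewrite mem_iota in j1l.
  split; first exact/asboolP.
  apply/allpairsP; exists ((j, a), C); split=> //=.
  by apply/allpairsPdep; exists j, a; rewrite mem_iota.
pose old := flatten [seq ldom l j | j <- iota 0 (lsize l)].
have oldP b : reflect (exists2 j, j < lsize l & b \in ldom l j) (b \in old).
  by apply: (iffP flatten_mapP) => -[j + jb]; rewrite ?mem_iota => jl; exists j;
    rewrite ?mem_iota.
have old_level b : b \in old ->
  b.1.1 <= i by case/oldP=> j jl /(co_level co jl).
have TE x : exists T : name -> set bform, x < size reqs ->
    let: (_, a, C) := nth r0 reqs x in
    [/\ forall b, mcs L (T b), forall b b', canE (T b) (T b'),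
        forall k b, k < lsize l -> b \in ldom l k -> canR (ltype l k b) (T b),
        ~ T a C &
        forall y D b, ~ T b (BBlack D) -> ~ T (i.+1, y, D) D].
  (* [setT] is a dummy value beyond the list of requests. *)
  have [xr|xr] := ltnP x (size reqs); last by exists (fun=> setT).
  have := mem_nth r0 xr; case: (nth r0 reqs x) => -[j a] C /reqsP[jl ja _ nC].
  by have [T hT] := request co jl ja nC; exists T.
have [F FP] := choice TE.
have Fm x b : x < size reqs -> mcs L (F x b).
  by move=> /FP; case: nth => -[? ?] ? [].
have FE x b b' : x < size reqs -> canE (F x b) (F x b').
  by move=> /FP; case: nth => -[? ?] ? [].
have FR x k b : x < size reqs -> k < lsize l -> b \in ldom l k ->
    canR (ltype l k b) (F x b).
  by move=> /FP; case: nth => -[? ?] ? [] _ _ h _ _; apply: h.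
have FB x y D b : x < size reqs -> ~ F x b (BBlack D) -> ~ F x (i.+1, y, D) D.
  by move=> /FP; case: nth => -[? ?] ? [] _ _ _ _ h; apply: h.
pose born (x : nat) : seq name := [seq (i.+1, x, D) | D <- Phi].
have bornP x b : b \in born x -> b.1 = (i.+1, x) by case/mapP=> D _ ->.
exists (Layer (size reqs) (fun x => old ++ born x) F); split; split=> /=.
- by move=> j a jl _; apply: Fm.
- by move=> j a jl; rewrite mem_cat => /orP[/old_level/leqW//|/bornP ->].
- by move=> j a b jl _ _; apply: FE.
- move=> j a C jl _ CP nC; exists (i.+1, j, C); last exact: FB nC.
  by rewrite mem_cat map_f ?orbT.
- move=> j k a T jl kl; rewrite !mem_cat => ja ka mT.
  (* Both types of an old individual are successors of one type in [l], so [canR_ath] applies; a new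
     individual lives only in the world its name records. *)
  have [/oldP[j0 j0l j0a]|aold] := boolP (a \in old).
    apply: (canR_ath bl (co_mcs co j0l j0a) (Fm _ a jl) (Fm _ a kl) mT);
      exact: FR.
  move: ja ka; rewrite (negbTE aold) /= => /bornP ja /bornP ka.
  by have [->] : (i.+1, j) = (i.+1, k) by rewrite -ja -ka.
(* A new world comes from a request, so [l] has a world and its common individual is old. *)
- have [e he] := co_common co; exists e => j jl.
  have := mem_nth r0 jl; case: (nth r0 reqs j) => -[j1 a1] C /reqsP[j1l _ _ _].
  by rewrite mem_cat; apply/orP; left; apply/oldP; exists j1 => //; apply: he.
- move=> j k a jl kl ja; split; last exact: FR.
  by rewrite mem_cat; apply/orP; left; apply/oldP; exists j.
- move=> j a C jl ja CP nC.
  have rin : (j, a, C) \in reqs by apply/reqsP.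
  exists (index (j, a, C) reqs); first by rewrite index_mem.
  have := FP (index (j, a, C) reqs); rewrite index_mem nth_index // => /(_ rin).
  by case.
- move=> /(mem_nth r0); case: (nth r0 reqs 0) => -[j a] C /reqsP[jl _ _ _].
  exact: leq_ltn_trans jl.
Qed.

(** Layer 0 is one world, drawn from the [canE] class of some [S] lacking [BBlack A]; the individual
    [(0, 0, A)] refutes [A] there. *)
Lemma layers A : A \in Phi -> ~ L A -> exists l : nat -> layer,
  [/\ exists a, [/\ 0 < lsize (l 0), a \in ldom (l 0) 0 & ~ ltype (l 0) 0 a A],
      forall i, coherent i (l i) & forall i, step (l i) (l i.+1)].
Proof.
move=> AP nA.
have [S [mS nSA]] : exists S, mcs L S /\ ~ S (BBlack A).
  apply: contrapT => nS; apply: nA; apply: (complete bl) => S mS;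
    apply: contrapT => nSA.
  by apply: nS; exists S; split=> // /(mcs_ax bl mS (bl_inst bl _)).
have [g gP] := choice (fun D => black_witness bl D mS).
have gE D D' : canE (g D) (g D').
  by have [_ h _] := gP D; have [_ h' _] := gP D';
    apply: canE_trans h (canE_sym h').
pose l0 := Layer 1 (fun=> [seq (0, 0, D) | D <- Phi]) (fun _ a => g a.2).
have co0 : coherent 0 l0.
  split=> /=.
  - by move=> j a _ _; have [] := gP a.2.
  - by move=> j a _ /mapP[D _ ->].
  - by move=> j a b _ _ _; apply: gE.
  - move=> j a C _ _ CP nC; exists (0, 0, C); first exact: map_f.
    by have [_ _] := gP C; apply=> SC; apply: nC; have [_ h _] := gP a.2;
      apply/h.
  - by [].
  - by exists (0, 0, A) => j _; apply: map_f.
(* Stated for all layers so that [choice] yields a function to iterate. *)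
have nxtE (p : nat * layer) : exists l',
    coherent p.1 p.2 -> coherent p.1.+1 l' /\ step p.2 l'.
  case: p => i l; have [co|nco] := pselect (coherent i l); last by exists l.
  by have [l' hl'] := next_layer co; exists l'.
have [nxt nxtP] := choice nxtE.
pose l := fix l i := if i is i'.+1 then nxt (i', l i') else l0.
have col i : coherent i (l i) by elim: i => //= i IHi;
  have [] := nxtP (i, l i) IHi.
exists l; split=> // [|i]; last by have [] := nxtP (i, l i) (col i).
exists (0, 0, A); split=> //=; first exact: map_f.
by have [_ _] := gP A; apply.
Qed.

(** Each step strips one box from the [N] boxes before bottom, so a world in layer [N] or beyond
    would be inconsistent. *)
Lemma layers_height l N : L (iter N BBox BBot) ->
  (forall i, coherent i (l i)) -> (forall i, step (l i) (l i.+1)) ->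
  forall i, 0 < lsize (l i) -> i < N.
Proof.
move=> LN co st.
have bot i j : j < lsize (l i) -> exists2 a, a \in ldom (l i) j &
    ltype (l i) j a (iter (N - i) BBox BBot).
  elim: i j => [|i IHi] j jl.
    have [a ha] := co_common (co 0); exists a; first exact: ha.
    by rewrite subn0; apply: th_logic LN; have [] := co_mcs (co 0) jl (ha j jl).
  have il := st_pos (st i) (leq_ltn_trans (leq0n j) jl).
  have [a ia] := IHi 0 il; have [ja aj] := st_acc (st i) il jl ia.
  rewrite subnS; case: (N - i) => [/(mcs_bot (co_mcs (co i) il ia))//|m /= am].
  by exists a => //; apply: aj.
move=> i il; rewrite ltnNge; apply/negP => Ni.
have [a ia] := bot i 0 il.
by move: Ni; rewrite -subn_eq0 => /eqP -> /(mcs_bot (co_mcs (co i) il ia)).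
Qed.

End Layers.

(** * From predicate logics to bimodal logics *)

Fixpoint unstar (B : bform) : pform :=
  match B with
  | BVar i => @PAtom 1 i [tuple 0]
  | BBot => PBot
  | BImp A B => PImp (unstar A) (unstar B)
  | BBox A => PBox (unstar A)
  | BBlack A => PAll (unstar A)
  end.

Lemma starK A : onevar A -> unstar (star A) = A.
Proof.
elim: A => //= [k i xs /eqP xs0|A IHA B IHB /andP[/IHA ->
  /IHB ->]|A IHA /IHA ->|A IHA /IHA ->] //.
have k1 : k = 1 by rewrite -(size_tuple xs) xs0.
by subst k; congr PAtom; apply: val_inj.
Qed.

(** Index 0 is the only one that occurs, and [up f] fixes it under quantifiers. *)
Lemma prename_unstar f B : f 0 = 0 -> prename f (unstar B) = unstar B.
Proof.
elim: B f => //= [i|A IHA B IHB|A IHA|A IHA] f f0; rewrite ?IHA ?IHB //.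
by congr PAtom; apply: val_inj; rewrite /= f0.
Qed.

Section PredicateLogic.
Variables (L : set pform) (hL : modal_pred_logic L).

Lemma pred_imp_id A : L (PImp A A).
Proof.
exact: (mpl_mp hL (mpl_mp hL (mpl_s hL A (PImp A A) A) (mpl_k hL A _)) (mpl_k hL A A)).
Qed.

Lemma pred_imp_trans A B C : L (PImp A B) -> L (PImp B C) -> L (PImp A C).
Proof.
move=> AB BC; apply: (mpl_mp hL (mpl_mp hL (mpl_s hL A B C) _) AB).
exact: (mpl_mp hL (mpl_k hL _ A) BC).
Qed.

Lemma pred_imp_cut A B C : L (PImp A (PImp B C)) -> L B -> L (PImp A C).
Proof.
move=> ABC LB; apply: (mpl_mp hL (mpl_mp hL (mpl_s hL A B C) ABC)).
exact: (mpl_mp hL (mpl_k hL _ A) LB).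
Qed.

Lemma pred_closed_gen A B :
  prename succn A = A -> L (PImp A B) -> L (PImp A (PAll B)).
Proof.
by move=> cA /(mpl_gen hL); apply: (mpl_mp hL); rewrite -{1}cA; apply: mpl_all.
Qed.

Lemma pred_box A B : L (PImp (PBox (PImp A B)) (PImp (PBox A) (PBox B))).
Proof.
have := mpl_subst hL (fun _ i => if i is 0 then A else B) (mpl_box hL).
rewrite /psubst /=.
by rewrite psubst0_rename !prename_id.
Qed.

Lemma pred_inst B : L (PImp (PAll (unstar B)) (unstar B)).
Proof. by have := mpl_inst hL (unstar B) 0; rewrite /pinst prename_unstar. Qed.

(** Since [PAll (unstar B)] is closed, a quantifier can be added to whatever it implies; this gives
    the S5 axioms and commutation. *)
Lemma unstar_bimodal : L (pform_of Ath) ->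
  bimodal_logic (fun B => L (unstar B)).
Proof.
have closed B : prename succn (PAll (unstar B)) = PAll (unstar B).
  by rewrite /= prename_unstar.
move=> LAth; split=> /= [A B|A B C|A|A B|A B|A|A B|A|A|A|A|A|A].
- exact: mpl_k.
- exact: mpl_s.
- exact: mpl_dn.
- exact: mpl_mp.
- exact: pred_box.
- exact: mpl_nec.
- have AB : L (PImp (PAll (PImp (unstar A) (unstar B)))
                    (PImp (PAll (unstar A)) (unstar B))).
    apply: pred_imp_trans (pred_inst (BImp A B)) _.
    exact: (pred_imp_cut (pred_imp_trans (mpl_k hL _ _) (mpl_s hL _ _ _)) (pred_inst A)).
  apply: (pred_imp_trans (pred_closed_gen (closed (BImp A B)) AB)).
  by rewrite -{1}(closed A); apply: mpl_all.
- exact: mpl_gen.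
- exact: pred_inst.
- exact: (pred_closed_gen (closed A) (pred_imp_id _)).
- apply: (pred_closed_gen _ (pred_imp_id _)).
  by have := closed A; rewrite /= => ->.
- apply: pred_closed_gen; first by have := closed A; rewrite /= => ->.
  exact: (mpl_mp hL (pred_box _ _) (mpl_nec hL (pred_inst A))).
(* The variable of [unstar A] is a parameter of the substitution for a 0-ary letter. *)
- have := mpl_subst hL (fun _ _ => unstar A) LAth; rewrite /psubst /=.
  by rewrite psubst0_rename !prename_id.
Qed.

End PredicateLogic.

(** * The finite frame built from the layers *)

Fixpoint subforms (B : bform) : seq bform :=
  B :: match B with
       | BImp A B => subforms A ++ subforms B
       | BBox A | BBlack A => subforms A
       | _ => [::]
       end.

Fixpoint bdepth (B : bform) : nat :=
  match B with
  | BImp A B => maxn (bdepth A) (bdepth B)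
  | BBox A => (bdepth A).+1
  | BBlack A => bdepth A
  | _ => 0
  end.

Section LayerFrame.
Variables (L : set bform) (bl : bimodal_logic L) (Phi : seq bform).
Variables (l : nat -> layer) (d : nat).
Hypotheses (l_pos : 0 < lsize (l 0)) (co : forall i, coherent L Phi i (l i)).
Hypothesis st : forall i, step Phi (l i) (l i.+1).

(* Cutting at the box depth [d] of the refuted formula makes the frame
   finite. *)
Definition lworld : Type := {i : 'I_d.+1 & 'I_(lsize (l i))}.

Definition ltag (u : lworld) : nat := tag u.

Definition lacc (u v : lworld) : Prop := ltag v = (ltag u).+1.

Definition lindiv (u : lworld) : set name :=
  [set` ldom (l (ltag u)) (tagged u)].

Lemma lworld_inhabited : inhabited lworld.
Proof. by constructor; exists ord0; exists 0. Qed.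

Lemma lindiv_nonempty u : lindiv u !=set0.
Proof. by have [a ha] := co_common (co (ltag u)); exists a; apply: ha. Qed.

Lemma lacc_step u v : lacc u v -> step Phi (l (ltag u)) (l (ltag v)).
Proof. by move=> ->. Qed.

Lemma lindiv_mono u v : lacc u v -> lindiv u `<=` lindiv v.
Proof.
by move=> /lacc_step uv a ua;
  have [] := st_acc uv (ltn_ord (tagged u)) (ltn_ord (tagged v)) ua.
Qed.

Definition layer_frame : pframe :=
  PFrame lworld_inhabited lindiv_nonempty lindiv_mono.

Lemma layer_frame_finite : finite_pframe layer_frame.
Proof. by split=> [|u]; [exact: finite_finset|exact: finite_seq]. Qed.

(** All successors of a world lie in one layer and hence see the same worlds. *)
Lemma layer_frame_Ath : frame_logic layer_frame (pform_of Ath).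
Proof.
move=> V u e _ /= h v uv hv; apply: h => v' uv'; apply=> w v'w; apply: hv.
by rewrite /= /lacc v'w uv uv'.
Qed.

Lemma layer_frame_height N : (forall i, 0 < lsize (l i) -> i < N) ->
  frame_logic layer_frame (pform_of (iter N MBox MBot)).
Proof.
move=> lN V u e _.
suff h m : N <= m + ltag u -> truth V u e (pform_of (iter m MBox MBot)).
  by apply: h; apply: leq_addr.
elim: m u => [|m IHm] u /= Nu.
  have /lN := leq_ltn_trans (leq0n _) (ltn_ord (tagged u)).
  by rewrite ltnNge Nu.
by move=> v uv; apply: IHm; rewrite uv addnS -addSn.
Qed.

Definition lval : valuation layer_frame := fun u k i xs =>
  exists2 a, val xs = [:: a] & ltype (l (ltag u)) (tagged u) a (BVar i).

(** The truth lemma. Subformulas must lie in [Phi] to have witnesses, and the depth bound keeps the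
    layers reached within the cut at [d]. *)
Lemma layer_frame_truth B u e : {subset subforms B <= Phi} ->
  ltag u + bdepth B <= d -> lindiv u (e 0) ->
  truth lval u e (unstar B) <-> ltype (l (ltag u)) (tagged u) (e 0) B.
Proof.
have hm (v : lworld) a : lindiv v a -> mcs L (ltype (l (ltag v)) (tagged v) a).
  exact: (co_mcs (co _)) (ltn_ord _).
elim: B u e => [i|//|A IHA B IHB|A IHA|A IHA] u e sub /= ud ue.
- by split=> [[a [->]]|h] //; exists (e 0).
- by split=> // /(mcs_bot (hm _ _ ue)).
- rewrite (mcs_imp bl _ _ (hm _ _ ue)) IHA ?IHB //.
  + by move=> C CB; apply: sub; rewrite inE mem_cat CB !orbT.
  + by apply: leq_trans ud; rewrite leq_add2l leq_maxr.
  + by move=> C CB; apply: sub; rewrite inE mem_cat CB !orbT.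
  + by apply: leq_trans ud; rewrite leq_add2l leq_maxl.
- have subA : {subset subforms A <= Phi}.
    by move=> C CA; apply: sub; rewrite inE CA orbT.
  have AP : A \in Phi by apply: subA; case: (A) => *; rewrite inE eqxx.
  split=> [h|uA v uv].
    apply: contrapT => nA.
    have [k kl] := st_wit (st (ltag u)) (ltn_ord (tagged u)) ue AP nA.
    have id : (ltag u).+1 < d.+1.
      by rewrite ltnS; apply: leq_trans ud; rewrite addnS ltnS leq_addr.
    pose v : lworld := existT _ (Ordinal id) (Ordinal kl).
    have uv : lacc u v by [].
    by apply; apply/(IHA v) => //;
      [rewrite addSnnS|apply: lindiv_mono ue|apply: h].
  have ve := lindiv_mono uv ue.
  apply/IHA => //; first by rewrite uv addSnnS.
  have [_] := st_acc (lacc_step uv) (ltn_ord (tagged u)) (ltn_ord (tagged v)) ue.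
  exact.
- have subA : {subset subforms A <= Phi}.
    by move=> C CA; apply: sub; rewrite inE CA orbT.
  have AP : A \in Phi by apply: subA; case: (A) => *; rewrite inE eqxx.
  split=> [h|uA a ua].
    apply: contrapT => nA.
    have [b ub] := co_wit (co (ltag u)) (ltn_ord (tagged u)) ue AP nA.
    by apply; apply/(IHA u (scons b e)) => //; apply: h.
  apply/IHA => //; apply: (mcs_ax bl (hm _ _ ua) (bl_inst bl A)).
  exact/(co_eq (co _) (ltn_ord _) ue ua).
Qed.

End LayerFrame.

(** * Finite countermodels and completeness *)

Lemma finite_countermodel L A : modal_pred_logic L -> L (pform_of Ath) ->
  onevar A -> ~ L A ->
  exists F : pframe, [/\ finite_pframe F, ~ valid F A,
    frame_logic F (pform_of Ath) &
    forall N, L (pform_of (iter N MBox MBot)) ->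
      frame_logic F (pform_of (iter N MBox MBot))].
Proof.
move=> hL LAth oA nA; have bl := unstar_bimodal hL LAth.
set B := star A; have eA : unstar B = A by apply: starK.
have BP : B \in subforms B by case: (B) => *; rewrite inE eqxx.
have nB : ~ L (unstar B) by rewrite eA.
have [l [[a [l0 l0a nBa]] co st]] := layers bl BP nB.
exists (layer_frame (bdepth B) l0 co st); split.
- exact: layer_frame_finite.
- pose u0 : lworld l (bdepth B) := existT _ ord0 (Ordinal l0).
  move=> vA; apply: nBa.
  have := valid_const (@lval _ _ l (bdepth B) l0 co st) (u := u0) (a :=
    a) vA l0a; rewrite -eA.
  by move/(@layer_frame_truth _ bl _ l (bdepth B) l0 co st); apply.
- exact: layer_frame_Ath.
- move=> N LN; apply: layer_frame_height; apply: (layers_height _ co st).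
  by move: LN; congr L; elim: N => //= N ->.
Qed.

Theorem corollary6p2 (Lam : set mform)
  (hLam : Lam = logic_add logicK Ath \/
          exists2 n : nat, (1 <= n)%N &
            Lam = logic_add (logic_add logicK (iter n MBox MBot)) Ath)
  (A : pform) (hA : onevar A) :
  fragment1 (logicQ Lam) (star A) <->
  (forall F : pframe,
     validates F (logicQ Lam) -> finite_pframe F -> valid F A).
Proof.
split=> [[B [QB oB] eBA] F vF _|h].
  (* [star] is injective on one-variable formulas, so [B] is [A]. *)
  by rewrite -(starK hA) -eBA starK //; apply: vF.
exists A => //; split=> //; apply: contrapT => nA.
have LamQ C : Lam C -> logicQ Lam (pform_of C).
  by move=> LC L _ LamL; apply: LamL; exists C.
have LamAth : Lam Ath by case: hLam => [|[n _]] -> L _ _.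
have [F [finF nF FAth FN]] :=
  finite_countermodel (logicQP Lam) (LamQ _ LamAth) hA nA.
apply: nF; apply: h => // B QB; apply: frame_logic_valid.
have nlF := normal_logic_pform_of (frame_logicP F).
(* The logic of [F] is a modal predicate logic, so it only has to contain [Lam]. *)
apply: (QB _ (frame_logicP F)) => _ [C LC <-].
case: hLam => [|[n _]] eLam; move: (LC); rewrite eLam => LC'.
  by apply: (LC' _ nlF) => // D KD; apply: (KD _ nlF).
apply: (LC' _ nlF) => // D LD; apply: (LD _ nlF) => [E KE|];
  first exact: (KE _ nlF).
by apply: FN; apply: LamQ; rewrite eLam => L' _ sub _; apply: sub => L'' _ _.
Qed.
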